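(* Let $G$ be a connected simple graph of order $n$ with clique number $\omega$. (i) If $\omega=2$, then $q_1(G)\ge 2+2\cos\frac{\pi}{n}$, with equality if and only if $G$ is the path of order $n$. (ii) If $\omega\ge 3$, then $q_1(G)\ge q_1(Ki_{n,\omega})$, with equality if and only if $G$ is the kite graph $Ki_{n,\omega}$.
   Context: $q_1(G)$ denotes the largest eigenvalue of the signless Laplacian $Q(G)=D(G)+A(G)$ ($D(G)$ the diagonal degree matrix, $A(G)$ the adjacency matrix). The clique number is the order of a largest complete subgraph. The kite graph $Ki_{n,\omega}$ is the graph of order $n$ obtained from a complete graph $K_\omega$ and a path $P_{n-\omega}$ on $n-\omega$ vertices by joining one vertex of $K_\omega$ to one end vertex of the path by an edge (for $n=\omega$ it is $K_\omega$). *)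

(* Defs.v *)
From HB Require Import structures.
From mathcomp Require Import all_boot all_order all_algebra.
From mathcomp Require Import classical_sets reals trigo.

Set Implicit Arguments.
Unset Strict Implicit.
Unset Printing Implicit Defensive.

Import Order.TTheory GRing.Theory Num.Theory.
Local Open Scope ring_scope.

Definition simple_graph (T : finType) (e : rel T) : Prop :=
  symmetric e /\ irreflexive e.

(* The graph on no vertices is not connected. *)
Definition connected_graph (T : finType) (e : rel T) : Prop :=
  (0 < #|T|)%N /\ forall x y : T, connect e x y.

Definition graph_iso (T U : finType) (e : rel T) (f : rel U) : Prop :=
  exists2 h : T -> U, bijective h & {mono h : x y / e x y >-> f x y}.

Definition clique (T : finType) (e : rel T) (A : {set T}) : bool :=
  [forall x in A, forall y in A, (x != y) ==> e x y].

Definition clique_number (T : finType) (e : rel T) : nat :=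
  \max_(A : {set T} | clique e A) #|A|.

Definition degree (T : finType) (e : rel T) (x : T) : nat :=
  #|[set y | e x y]|.

(* The vertices are numbered by the canonical enumeration of T. *)
Definition adjacency (R : realType) (T : finType) (e : rel T) : 'M[R]_#|T| :=
  \matrix_(i, j) (e (enum_val i) (enum_val j))%:R.

Definition degree_mx (R : realType) (T : finType) (e : rel T) : 'M[R]_#|T| :=
  diag_mx (\row_i (degree e (enum_val i))%:R).

Definition signless_laplacian (R : realType) (T : finType) (e : rel T) :
    'M[R]_#|T| :=
  degree_mx R e + adjacency R e.

(* For a simple graph with at least one vertex this matrix is real symmetric of
   positive order, so its set of eigenvalues in R is finite and nonempty and the
   supremum is the largest eigenvalue. *)
Definition q1 (R : realType) (T : finType) (e : rel T) : R :=
  sup [set a : R | eigenvalue (signless_laplacian R e) a]%classic.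

Definition consecutive (i j : nat) : bool := (i.+1 == j) || (j.+1 == i).

Definition path_graph (n : nat) : rel 'I_n :=
  fun i j => consecutive i j.

(* K_w lives on the vertices 0, ..., w - 1 and the path on w, ..., n - 1; the
   joining edge is {w - 1, w}, which is absent when n = w. Intended for
   0 < w <= n. *)
Definition kite_graph (n w : nat) : rel 'I_n :=
  fun i j => [|| [&& (i < w)%N, (j < w)%N & i != j],
                 [&& (w <= i)%N, (w <= j)%N & consecutive i j],
                 (i.+1 == w) && (j == w :> nat)
               | (j.+1 == w) && (i == w :> nat)].

(* Main.v *)
Require Import Defs.
From mathcomp Require Import all_boot all_order all_algebra.
From mathcomp Require Import zify ring lra.
From mathcomp Require Import boolp classical_sets reals topology normedtype.
From mathcomp Require Import derive trigo.

Set Implicit Arguments.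
Unset Strict Implicit.
Unset Printing Implicit Defensive.

Import Order.TTheory GRing.Theory Num.Theory.
Import numFieldNormedType.Exports.
Local Open Scope ring_scope.

(** [q1] is the maximum of [\sum_(uv edge) (x u + x v)^2 / \sum_u (x u)^2].
    The positive eigenvector [f] of the kite decreases strictly along the path
    and is larger on the clique.  List the vertices of [G] as [v_0, v_1, ...],
    a maximum clique first and every later vertex adjacent to an earlier one,
    with [v_w] adjacent to [v_(w-1)], and use [x (v_k) = f k] as a test vector:
    for [k >= w] the vertex [v_k] has a neighbour [v_j] with [j < k], and either
    [j = k - 1] or [f j > f (k - 1)], so each later vertex contributes at least
    as much as in the kite, with equality only for the kite.
    For [w = 2], a vertex of degree at least 3, or minimum degree at least 2,
    already forces [q1 >= 4]; the only other connected graph is the path. *)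

(** * Maxima of quadratic forms on the unit sphere *)

Lemma continuous_sumr (R : realType) (I : finType) (U : topologicalType)
    (F : I -> U -> R) :
  (forall i, continuous (F i)) -> continuous (fun x => \sum_i F i x).
Proof.
move=> cF x; apply: cvg_big => [|i _]; first exact: add_continuous.
exact: cF.
Qed.

Section SymmetricMatrices.
Variables (R : realType) (n : nat).
Implicit Types (M N : 'M[R]_n) (x y : 'rV[R]_n).

Lemma mulmx_tr_ge0 x : 0 <= (x *m x^T) 0 0.
Proof.
by rewrite mxE; apply: sumr_ge0 => i _; rewrite mxE -expr2 sqr_ge0.
Qed.

Lemma mulmx_tr_eq0 x : (x *m x^T) 0 0 = 0 -> x = 0.
Proof.
rewrite mxE => /eqP; rewrite psumr_eq0 => [/allP h|i _]; last first.
  by rewrite mxE -expr2 sqr_ge0.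
apply/rowP => i; have := h i (mem_index_enum _).
by rewrite !mxE -expr2 sqrf_eq0 => /eqP.
Qed.

(** With [y = x N], the form at [x - t y] is [t^2 r - 2 t s], where [s] is the squared norm of [y]
    and [r] the form at [y]. For small [t > 0] this is negative unless [s = 0]; the choice
    [t = s / (r + 1)] also covers [r = 0]. *)
Lemma psd_isotropic_ker N x : N^T = N ->
  (forall y, 0 <= (y *m N *m y^T) 0 0) -> (x *m N *m x^T) 0 0 = 0 ->
  x *m N = 0.
Proof.
move=> Nsym Npsd x0; apply: mulmx_tr_eq0; set y := x *m N.
set s := (y *m y^T) 0 0; set r := (y *m N *m y^T) 0 0.
have r0 : 0 <= r by exact: Npsd.
have s0 : 0 <= s by exact: mulmx_tr_ge0.
have cross : (y *m N *m x^T) 0 0 = s.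
  by rewrite -mulmxA /s; congr ((_ *m _) 0 0); rewrite /y trmx_mul Nsym.
have := Npsd (x - (s / (r + 1)) *: y).
rewrite mulmxBl linearB /= linearZ /= !mulmxBr !mulmxBl -!scalemxAl -!scalemxAr.
rewrite ![(_ - _ : 'M_1) 0 0]mxE ![(- _ : 'M_1) 0 0]mxE.
rewrite ![(_ + _ : 'M_1) 0 0]mxE ![(- _ : 'M_1) 0 0]mxE ![(_ *: _ : 'M_1) 0 0]mxE x0 -/y -/s.
rewrite cross -/r.
have r1 : r + 1 != 0 by rewrite gt_eqF // ltr_wpDl.
set t := s / (r + 1); have st : s = t * (r + 1) by rewrite /t divfK.
have t0 : 0 <= t by rewrite divr_ge0 // addr_ge0.
rewrite st => h; suff -> : t = 0 by rewrite mul0r.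
apply/eqP; rewrite -sqrf_eq0; apply/eqP.
nra.
Qed.

Lemma sphere_compact : compact [set x : 'rV[R]_n | (x *m x^T) 0 0 = 1]%classic.
Proof.
have cb := @rV_compact R n (fun=> `[(- 1 : R), 1]%classic)
  (fun=> @segment_compact R (- 1) 1).
apply: subclosed_compact cb _.
  have cf : continuous (fun x : 'rV[R]_n => (x *m x^T) 0 0).
    rewrite (_ : (fun _ => _) = fun x : 'rV[R]_n => \sum_i x 0 i * x 0 i).
      apply: continuous_sumr => i x.
      by have ci := @coord_continuous R 1 n 0 i x; exact: (continuousM ci ci).
    by apply/funext => y; rewrite mxE; apply: eq_bigr => i _; rewrite mxE.
  have := @preimage_closed _ _ _ [set (1 : R)]%classic (in1W cf); apply.
  exact: closed_eq.
move=> x /= x1 i; rewrite /= in_itv /= -ler_norml -(@ler_pXn2r _ 2) ?nnegrE //.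
rewrite expr1n real_normK ?num_real // -x1 mxE (bigD1 i) //= mxE -expr2.
by rewrite lerDl sumr_ge0 // => j _; rewrite mxE -expr2 sqr_ge0.
Qed.

(** The form attains its maximum on the compact unit sphere, and scaling by [c] multiplies both
    sides by [c ^+ 2]. *)
Lemma rayleigh_max M : (0 < n)%N -> exists a, exists2 x : 'rV[R]_n, x != 0 &
  (x *m M *m x^T) 0 0 = a * (x *m x^T) 0 0 /\
  forall y, (y *m M *m y^T) 0 0 <= a * (y *m y^T) 0 0.
Proof.
move=> n0.
have cM : continuous (fun x : 'rV[R]_n => (x *m M *m x^T) 0 0).
  rewrite (_ : (fun _ => _) =
      fun x : 'rV[R]_n => \sum_i (\sum_j x 0 j * M j i) * x 0 i).
    apply: continuous_sumr => i x; apply: continuousM; last exact: coord_continuous.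
    move: x; apply: continuous_sumr => j x.
    by apply: continuousM; [exact: coord_continuous | exact: cst_continuous].
  by apply/funext => y; rewrite mxE; apply: eq_bigr => i _; rewrite !mxE.
have norm2_gt0 y : y != 0 -> 0 < (y *m y^T) 0 0.
  move=> y0; rewrite lt_neqAle mulmx_tr_ge0 andbT eq_sym.
  by apply: contra_neq y0; exact: mulmx_tr_eq0.
have quadZ c y : ((c *: y) *m M *m (c *: y)^T) 0 0 = c ^+ 2 * (y *m M *m y^T) 0 0.
  by rewrite linearZ /= -!scalemxAl -scalemxAr scalerA mxE.
have normZ c y : ((c *: y) *m (c *: y)^T) 0 0 = c ^+ 2 * (y *m y^T) 0 0.
  by rewrite linearZ /= -!scalemxAl -scalemxAr scalerA mxE.
have normalize y : y != 0 -> exists2 c, 0 < c & ((c *: y) *m (c *: y)^T) 0 0 = 1.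
  move=> /norm2_gt0 h; exists (Num.sqrt ((y *m y^T) 0 0))^-1.
    by rewrite invr_gt0 sqrtr_gt0.
  by rewrite normZ exprVn sqr_sqrtr ?ltW // mulVf // gt_eqF.
have [] := @EVT_max_rV R n _ _ _ sphere_compact (continuous_subspaceT cM).
  have [|c _ c1] := normalize (const_mx 1).
    apply/eqP => /rowP /(_ (Ordinal n0)); rewrite !mxE => /eqP.
    by rewrite oner_eq0.
  by exists (c *: const_mx 1).
move=> x /set_mem /= x1 xmax; exists ((x *m M *m x^T) 0 0); exists x.
  apply: contra_eq_neq x1 => ->; rewrite mul0mx mxE eq_sym; exact: oner_neq0.
split=> [|y]; first by rewrite x1 mulr1.
have [->|y0] := eqVneq y 0; first by rewrite !mul0mx mxE mulr0.
have [c c0 yc] := normalize _ y0; have /= := xmax (c *: y).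
rewrite mem_set // quadZ => /(_ isT); rewrite normZ in yc.
by rewrite -[X in _ <= X -> _]mulr1 -yc mulrCA ler_pM2l // exprn_gt0.
Qed.

End SymmetricMatrices.

(** * The largest signless Laplacian eigenvalue as a Rayleigh maximum *)

Section SignlessRayleigh.
Variables (R : realType) (T : finType) (e : rel T).
Hypothesis sym_e : symmetric e.
Implicit Types (x y : T -> R) (u v : T).

Definition sqnorm x : R := \sum_u x u ^+ 2.

(* Every edge is counted once in each direction, so this is [2 x^T Q x]. *)
Definition energy x : R := \sum_u \sum_(v | e u v) (x u + x v) ^+ 2.

(** The coordinate at [u] of the signless Laplacian applied to [x]: the terms [x u] form the degree
    part, the terms [x v] the adjacency part. *)
Definition signless_op x u : R := \sum_(v | e u v) (x u + x v).

Definition rowf x : 'rV[R]_#|T| := \row_i x (enum_val i).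

Lemma sum_enum_val (F : T -> R) : \sum_(i < #|T|) F (enum_val i) = \sum_u F u.
Proof. by rewrite -big_enum_val. Qed.

Lemma rowf_enum (r : 'rV[R]_#|T|) : rowf (fun u => r 0 (enum_rank u)) = r.
Proof. by apply/rowP => i; rewrite mxE enum_valK. Qed.

Lemma sqnormE x : (rowf x *m (rowf x)^T) 0 0 = sqnorm x.
Proof.
rewrite mxE /sqnorm -(sum_enum_val (fun u => x u ^+ 2)).
by apply: eq_bigr => i _; rewrite !mxE expr2.
Qed.

Lemma signless_sym : (signless_laplacian R e)^T = signless_laplacian R e.
Proof.
rewrite /signless_laplacian linearD /= tr_diag_mx; congr (_ + _).
by apply/matrixP => i j; rewrite !mxE sym_e.
Qed.

Lemma rowf_signless x : rowf x *m signless_laplacian R e = rowf (signless_op x).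
Proof.
rewrite /signless_laplacian mulmxDr; apply/rowP => j.
rewrite [LHS]mxE mul_mx_diag !mxE /signless_op big_split /=; congr (_ + _).
  by rewrite sumr_const mulr_natr /degree cardsE.
rewrite [RHS]big_mkcond -sum_enum_val; apply: eq_bigr => i _.
by rewrite !mxE sym_e; case: (e _ _); rewrite ?mulr1 ?mulr0.
Qed.

Lemma energy_op x : energy x = 2 * \sum_u x u * signless_op x u.
Proof.
have swap : \sum_u \sum_(v | e u v) x v * (x u + x v) =
            \sum_u \sum_(v | e u v) x u * (x u + x v).
  rewrite (exchange_big_dep xpredT) //=; apply: eq_bigr => u _.
  by apply: eq_big => v; rewrite 1?sym_e // addrC.
under [X in _ * X]eq_bigr do rewrite mulr_sumr.
rewrite mulr_natl mulr2n -{1}swap -big_split /=.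
apply: eq_bigr => u _; rewrite -big_split /=; apply: eq_bigr => v _.
by rewrite -mulrDl addrC -expr2.
Qed.

Lemma energyE x :
  energy x = 2 * (rowf x *m signless_laplacian R e *m (rowf x)^T) 0 0.
Proof.
rewrite energy_op rowf_signless mxE.
rewrite -(sum_enum_val (fun u => x u * signless_op x u)); congr (_ * _).
by apply: eq_bigr => i _; rewrite !mxE mulrC.
Qed.

Lemma eigenvalue_signlessP a : reflect
  (exists2 x, exists u, x u != 0 & forall u, signless_op x u = a * x u)
  (eigenvalue (signless_laplacian R e) a).
Proof.
apply: (iffP eigenvalueP) => [[r rE r0] | [x [u xu0] xE]].
  exists (fun u => r 0 (enum_rank u)).
    move/rV0Pn: r0 => [i ri]; exists (enum_val i); by rewrite enum_valK.
  move=> u; move: rE; rewrite -{1}(rowf_enum r) rowf_signless.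
  by move/rowP/(_ (enum_rank u)); rewrite !mxE enum_rankK.
exists (rowf x).
  by rewrite rowf_signless; apply/rowP => i; rewrite !mxE xE.
by apply/rV0Pn; exists (enum_rank u); rewrite mxE enum_rankK.
Qed.

Hypothesis T_gt0 : (0 < #|T|)%N.

(** Let [a] be the Rayleigh maximum of [Q]. Then [a I - Q] is positive semidefinite, so every
    maximizer lies in its kernel. Each eigenvalue is the Rayleigh quotient of its eigenvectors,
    hence at most [a], and [a] is the supremum defining [q1]. *)
Lemma q1_rayleigh :
  [/\ forall x, energy x <= 2 * q1 R e * sqnorm x,
      forall x, energy x = 2 * q1 R e * sqnorm x ->
        forall u, signless_op x u = q1 R e * x u,
      exists2 x, exists u, x u != 0 & forall u, signless_op x u = q1 R e * x u
    & forall a x, (exists u, x u != 0) ->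
        (forall u, signless_op x u = a * x u) -> a <= q1 R e].
Proof.
set Q := signless_laplacian R e.
have [a [r r0 [ra amax]]] := rayleigh_max Q T_gt0.
have amaxE y : energy y <= 2 * a * sqnorm y.
  by rewrite energyE -mulrA ler_pM2l // -sqnormE.
have ker y : energy y = 2 * a * sqnorm y ->
    forall u, signless_op y u = a * y u.
  move=> yE.
  have /eqP : rowf y *m (a%:M - Q) = 0.
    apply: psd_isotropic_ker.
    - by rewrite linearB /= tr_scalar_mx signless_sym.
    - move=> z; rewrite mulmxBr mulmxBl mul_mx_scalar -scalemxAl !mxE.
      by move: (amax z); rewrite !mxE subr_ge0.
    - apply: (mulfI (_ : 2 != 0 :> R)); first by rewrite pnatr_eq0.
      rewrite mulmxBr mulmxBl mul_mx_scalar -scalemxAl.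
      rewrite [(_ - _ : 'M_1) 0 0]mxE [(- _ : 'M_1) 0 0]mxE.
      rewrite [(_ *: _ : 'M_1) 0 0]mxE.
      by rewrite mulrBr -energyE sqnormE yE mulrA subrr mulr0.
  rewrite mulmxBr mul_mx_scalar subr_eq0 rowf_signless => /eqP/rowP h u.
  by have := h (enum_rank u); rewrite !mxE enum_rankK.
have rE : energy (fun u => r 0 (enum_rank u)) =
    2 * a * sqnorm (fun u => r 0 (enum_rank u)).
  by rewrite energyE -sqnormE rowf_enum -mulrA ra.
have rne : exists u, r 0 (enum_rank u) != 0.
  by move/rV0Pn: r0 => [i ri]; exists (enum_val i); rewrite enum_valK.
have le_a b y : (exists u, y u != 0) ->
    (forall u, signless_op y u = b * y u) -> b <= a.
  move=> [u yu] yE; have := amaxE y.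
  rewrite energy_op -mulrA ler_pM2l //.
  under eq_bigr do rewrite yE mulrCA -expr2.
  rewrite -mulr_sumr ler_pM2r // /sqnorm (bigD1 u) //=.
  rewrite ltr_pwDl ?sumr_ge0 // => [|v _]; last exact: sqr_ge0.
  by rewrite lt_neqAle sqr_ge0 eq_sym sqrf_eq0 yu.
suff -> : q1 R e = a.
  by split=> //; exists (fun u => r 0 (enum_rank u)) => //; apply: ker.
have aQ : eigenvalue Q a.
  by apply/eigenvalue_signlessP; exists (fun u => r 0 (enum_rank u)) => //; exact: ker.
have ubQ : ubound [set b : R | eigenvalue Q b]%classic a.
  by move=> b /= /eigenvalue_signlessP [y y0 yE]; exact: le_a yE.
apply/eqP; rewrite eq_le /q1; apply/andP; split.
  by apply: ge_sup => //; exists a.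
by apply: ub_le_sup => //; exists a.
Qed.

End SignlessRayleigh.

(** * Perron vectors and vertex orderings of connected graphs *)

Section ConnectedGraphs.
Variables (R : realType) (T : finType) (e : rel T).
Hypotheses (sym_e : symmetric e) (conn_e : connected_graph e).

(** Taking absolute values of an eigenvector for [q1] keeps the norm and does not lower the energy,
    so the result is again a maximizer and hence an eigenvector. *)
Lemma perron : exists2 x : T -> R, forall u, 0 < x u &
  forall u, signless_op e x u = q1 R e * x u.
Proof.
have [T_gt0 conn] := conn_e.
have [qmax qker [x [u0 xu0] xE] _] := q1_rayleigh R sym_e T_gt0.
pose y u : R := `|x u|.
have yE u : signless_op e y u = q1 R e * y u.
  apply: qker; apply/eqP; rewrite eq_le qmax /=.
  have -> : sqnorm y = sqnorm x.
    by apply: eq_bigr => v _; rewrite real_normK ?num_real.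
  have -> : 2 * q1 R e * sqnorm x = energy e x.
    rewrite energy_op // -mulrA; congr (_ * _); rewrite /sqnorm mulr_sumr.
    by apply: eq_bigr => v _; rewrite xE expr2 mulrCA.
  apply: ler_sum => v _; apply: ler_sum => v' _.
  rewrite -[X in X <= _]real_normK ?num_real // lerXn2r ?nnegrE //.
    by rewrite addr_ge0 ?normr_ge0.
  exact: ler_normD.
(* At a zero of [y] the eigenvalue equation is a vanishing sum of nonnegative terms, so zeros spread
   to neighbours. *)
have zero_closed : fingraph.closed e [pred u | y u == 0].
  apply: intro_closed => [|u v euv]; first exact: sym_connect_sym.
  rewrite !inE => /eqP yu; have := yE u.
  rewrite yu mulr0 => /eqP; rewrite psumr_eq0 => [/allP h|w _]; last first.
    by rewrite addr_ge0 ?normr_ge0.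
  by have := h v (mem_index_enum _); rewrite euv yu add0r.
exists y => // u; rewrite lt_neqAle normr_ge0 andbT eq_sym.
have := closed_connect zero_closed (conn u u0); rewrite !inE => ->.
by rewrite normr_eq0.
Qed.

(** Lets [q1] of the path be read off from an explicit positive eigenvector. *)
Lemma positive_eigenvector_q1 (a : R) (x : T -> R) : (forall u, 0 < x u) ->
  (forall u, signless_op e x u = a * x u) -> q1 R e = a.
Proof.
move=> x_gt0 xE; have [y y_gt0 yE] := perron.
have [/card_gt0P [u0 _] _] := conn_e.
have [_ _ _ qmax] := q1_rayleigh R sym_e conn_e.1.
apply/eqP; rewrite eq_le; apply/andP; split; last first.
  by apply: (qmax _ x) => //; exists u0; rewrite gt_eqF.
(* compare the two equations at a vertex maximizing y / x *)
case: (@arg_maxP _ _ _ u0 xpredT (fun u => y u / x u)) => // u _ umax.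
rewrite -(ler_pM2r (y_gt0 u)) -yE.
have yx v : y v <= y u / x u * x v.
  by rewrite -ler_pdivrMr //; exact: umax.
apply: (@le_trans _ _ (y u / x u * signless_op e x u)).
  rewrite mulr_sumr; apply: ler_sum => v _.
  by rewrite mulrDr lerD.
by rewrite xE mulrCA divfK ?gt_eqF.
Qed.

(** The star with three leaves has [q1 = 4], and its eigenvalue equations survive as inequalities
    because further edges only add nonnegative terms. The rows at the leaves and at [u] combine to
    [3 <= (q - 1) (q - 3)]. *)
Lemma q1_ge4_degree3 (u a b c : T) : e u a -> e u b -> e u c ->
  a != b -> a != c -> b != c -> 4 <= q1 R e.
Proof.
move=> ua ub uc ab ac bc; have [x x_gt0 xE] := perron.
set q := q1 R e in xE *.
have terms_ge0 v w : 0 <= x v + x w by rewrite addr_ge0 ?ltW.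
have leaf v : e u v -> x u <= (q - 1) * x v.
  move=> uv; have := xE v; rewrite /signless_op (bigD1 u) /=; last by rewrite sym_e.
  have := @sumr_ge0 R _ (index_enum T) (fun w => e v w && (w != u))
    (fun w => x v + x w) (fun w _ => terms_ge0 v w).
  by move: (\sum_(_ | _) _) => s s0 h; lra.
have root : 3 * x u + (x a + x b + x c) <= q * x u.
  rewrite -xE /signless_op (bigD1 a) //= (bigD1 b) /=; last by rewrite ub eq_sym.
  rewrite (bigD1 c) /=; last by rewrite uc eq_sym ac eq_sym.
  set s := \sum_(_ | _) _; have : 0 <= s by exact: sumr_ge0.
  by move=> s0; lra.
have := leaf a ua; have := leaf b ub; have := leaf c uc.
have := x_gt0 u; have := x_gt0 a; have := x_gt0 b; have := x_gt0 c.
move=> xc xb xa xu lc lb la.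
have q3 : 3 < q by nra.
have h : 3 * x u <= (q - 1) * (x a + x b + x c) by lra.
have : 3 * x u <= (q - 1) * ((q - 3) * x u).
  by apply: (le_trans h); rewrite ler_pM2l; lra.
rewrite mulrA ler_pM2r // => hq; nra.
Qed.

Lemma crossing_edge (S : {pred T}) a b : a \in S -> b \notin S ->
  exists u v, [/\ u \in S, v \notin S & e u v].
Proof.
move=> aS bS; have [_ conn] := conn_e.
case: (boolP [exists u, exists v, [&& u \in S, v \notin S & e u v]]).
  by move=> /existsP[u /existsP[v /and3P[]]]; exists u, v.
move=> /existsPn h; have clS : fingraph.closed e S.
  apply: intro_closed => [|u v euv uS]; first exact: sym_connect_sym.
  by have /existsPn /(_ v) := h u; rewrite uS euv andbT negbK.
by move: bS; rewrite -(closed_connect clS (conn a b)) aS.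
Qed.

(** Greedy growth: while a vertex is missing, some edge leaves the listed set, and its outer
    endpoint is appended. *)
Lemma attached_enumeration (s : seq T) : uniq s -> (0 < size s)%N ->
  exists t, [/\ uniq (s ++ t), s ++ t =i T &
    forall x0 k, (size s <= k < size (s ++ t))%N ->
      exists2 i, (i < k)%N & e (nth x0 (s ++ t) i) (nth x0 (s ++ t) k)].
Proof.
have [m] := ubnP (#|T| - size s); elim: m s => // m IH s le_m us s_gt0.
case: (leqP #|T| (size s)) => [sT | sT].
  exists [::]; rewrite cats0; split => // [u|x0 k]; last by lia.
  have [||_ sE] := @uniq_min_size _ s (enum T) us; rewrite -?cardE //.
    by move=> v _; rewrite mem_enum.
  by rewrite sE mem_enum.
have [b bs] : exists b, b \notin s.
  apply/existsP; rewrite -negb_forall; apply: contraL sT => /forallP sT.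
  rewrite -leqNgt -(card_uniqP us); apply/eq_leq/esym/eq_card => v.
  by rewrite (sT v).
have [a as_] : exists a, a \in s.
  by case: (s) s_gt0 => // a s' _; exists a; rewrite mem_head.
have [u [v [us' vs euv]]] := crossing_edge as_ bs.
have [|||t [ut tT att]] := IH (rcons s v); rewrite ?size_rcons ?rcons_uniq ?vs //.
  by rewrite subnS prednK ?subn_gt0 // in le_m *; lia.
exists (v :: t); rewrite -cat_rcons; split => // x0 k /andP[sk kt].
have [sk'|ks|ks] := ltngtP k (size s); first by lia.
  by apply: att; rewrite size_rcons ks kt.
(* Position [size s] holds [v], whose earlier neighbour is [u]. *)
exists (index u s); first by rewrite ks index_mem.
rewrite ks cat_rcons !nth_cat index_mem us' ltnn subnn nth_index //=.
Qed.

(** Numbers the vertices by ['I_#|T|], so that the graph can be pulled back to the vertex set of a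
    kite or a path. *)
Lemma attached_ordering (s : seq T) : uniq s -> (0 < size s)%N ->
  exists2 h : 'I_#|T| -> T, bijective h &
    (forall x0 (i : 'I_#|T|), (i < size s)%N -> h i = nth x0 s i) /\
    (forall k : 'I_#|T|, (size s <= k)%N ->
       exists2 i : 'I_#|T|, (i < k)%N & e (h i) (h k)).
Proof.
move=> us s_gt0; have [t [ut tT att]] := attached_enumeration us s_gt0.
have size_st : size (s ++ t) = #|T| by rewrite -(card_uniqP ut); apply: eq_card.
have [/card_gt0P [x0 _] _] := conn_e.
exists (fun i : 'I__ => nth x0 (s ++ t) i).
  apply: inj_card_bij; last by rewrite card_ord.
  move=> i j /eqP; rewrite nth_uniq ?size_st // => /eqP; exact: val_inj.
split=> [x1 i si|k sk].
  by rewrite nth_cat si; apply: set_nth_default.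
have [|i ik ek] := att x0 k; first by rewrite sk size_st ltn_ord.
by exists (Ordinal (ltn_trans ik (ltn_ord k))).
Qed.

End ConnectedGraphs.

(** * Invariance of [q1] under isomorphism *)

Section GraphIsomorphism.
Variable R : realType.

Lemma graph_iso_sym (T U : finType) (e : rel T) (f : rel U) :
  graph_iso e f -> graph_iso f e.
Proof.
move=> [h [h' hK h'K] hm]; exists h'; first by exists h.
by move=> x y; rewrite -hm !h'K.
Qed.

Lemma signless_op_iso (T U : finType) (e : rel T) (f : rel U) (h : T -> U)
    (x : U -> R) u : bijective h -> {mono h : x y / e x y >-> f x y} ->
  signless_op e (x \o h) u = signless_op f x (h u).
Proof.
move=> hb hm; rewrite [RHS](reindex h) /=; last exact: onW_bij.
by apply: eq_bigl => v; rewrite hm.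
Qed.

Lemma q1_iso (T U : finType) (e : rel T) (f : rel U) :
  symmetric e -> symmetric f -> graph_iso e f -> q1 R e = q1 R f.
Proof.
move=> se sf; suff sub (T' U' : finType) (e' : rel T') (f' : rel U') a :
    symmetric e' -> symmetric f' -> graph_iso e' f' ->
    eigenvalue (signless_laplacian R f') a ->
    eigenvalue (signless_laplacian R e') a.
  move=> ef; congr sup; apply/seteqP; split=> a /=; last exact: sub.
  by apply: sub => //; exact: graph_iso_sym.
move=> se' sf' [h hb hm] /(eigenvalue_signlessP sf')[x [u xu] xE].
apply/(eigenvalue_signlessP se'); exists (x \o h).
  by have [h' hK h'K] := hb; exists (h' u); rewrite /= h'K.
by move=> v; rewrite (signless_op_iso x v hb hm) xE.
Qed.

Lemma graph_iso_relpre (T U : finType) (e : rel T) (h : U -> T) :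
  bijective h -> graph_iso (relpre h e) e.
Proof. by move=> hb; exists h. Qed.

End GraphIsomorphism.

(** * Adjacency in the kite graph *)

Section KiteGraphs.
Variables (n w : nat).
Implicit Types i j k : 'I_n.

Lemma kite_graph_sym : symmetric (@kite_graph n w).
Proof.
move=> i j; rewrite /kite_graph /consecutive -!val_eqE /=; lia.
Qed.

Lemma kite_graph_irr : irreflexive (@kite_graph n w).
Proof. by move=> i; rewrite /kite_graph /consecutive -!val_eqE /=; lia. Qed.

Lemma kite_graph_lt i j : (i < j)%N ->
  kite_graph w i j = (j < w)%N || (i.+1 == j).
Proof. by rewrite /kite_graph /consecutive -!val_eqE /=; lia. Qed.

Lemma kite_graph_path i j : (w <= i)%N -> kite_graph w i j = consecutive i j.
Proof. by rewrite /kite_graph /consecutive -!val_eqE /=; lia. Qed.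

Lemma kite_graph_clique i j : (i.+1 < w)%N ->
  kite_graph w i j = (j < w)%N && (j != i).
Proof. by rewrite /kite_graph /consecutive -!val_eqE /=; lia. Qed.

Lemma kite_graph_joint i j : i.+1 = w ->
  kite_graph w i j = ((j < w)%N && (j != i)) || (j == w :> nat).
Proof. by rewrite /kite_graph /consecutive -!val_eqE /=; lia. Qed.

Lemma kite_graph_connected : (0 < n)%N -> connected_graph (@kite_graph n w).
Proof.
move=> n_gt0; split; first by rewrite card_ord.
have conn0 k : connect (@kite_graph n w) (Ordinal n_gt0) k.
  case: k => k; elim: k => [|k IH] kn.
    by rewrite (_ : Ordinal kn = Ordinal n_gt0) ?connect0 //; exact: val_inj.
  have kn' : (k < n)%N by exact: ltnW.
  apply: (connect_trans (IH kn')); apply: connect1.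
  by rewrite kite_graph_lt //= eqxx orbT.
move=> i j; apply: connect_trans (conn0 j).
by rewrite (sym_connect_sym kite_graph_sym).
Qed.

End KiteGraphs.

(** * The Perron vector of the kite *)

Section KitePerron.
Variables (R : realType) (n w : nat) (x : 'I_n -> R).
Hypotheses (w_ge3 : (3 <= w)%N) (w_le_n : (w <= n)%N).
Let q := q1 R (@kite_graph n w).
Hypotheses (x_gt0 : forall i, 0 < x i)
  (xE : forall i, signless_op (@kite_graph n w) x i = q * x i).
Implicit Types i j k : 'I_n.

Let w_gt0 : (0 < w)%N. Proof. exact: leq_trans w_ge3. Qed.

Let S := \sum_(j < n | (j < w)%N) x j.

(** Neither [S] nor the factor depends on [i], so once the factor is nonzero, [x] is constant on the
    clique away from the joint [w - 1]. *)
Lemma kite_perron_clique i : (i.+1 < w)%N -> (q - w%:R + 2) * x i = S.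
Proof.
move=> iw; have := xE i; rewrite /signless_op.
rewrite (eq_bigl _ _ (fun j => kite_graph_clique j iw)) => row.
have : \sum_(j < n | (j < w)%N) (x i + x j) = w%:R * x i + S.
  rewrite big_split /=; congr (_ + _).
  rewrite -(big_ord_widen n (fun=> x i) w_le_n) sumr_const card_ord.
  by rewrite mulr_natl.
by rewrite (bigD1 i) /= ?row ?(ltnW iw) // => h; lra.
Qed.

(** Induction from the free end. There the row of [k] gives [x i = (q - 1) x k]; elsewhere it gives
    [x i = (q - 2) x k - x (k + 1)], and [x (k + 1) < x k] by induction since [q >= 4]. The factor
    [q - 3] is what the comparison across the joint uses. *)
Lemma kite_perron_path i k : (w <= k)%N -> i.+1 = k -> 4 <= q ->
  (q - 3) * x k < x i.
Proof.
move=> + + q4; have [m] := ubnP (n - k); elim: m => // m IH in i k *.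
move=> km wk ik; have := xE k; rewrite /signless_op.
rewrite (eq_bigl _ _ (fun j => kite_graph_path j wk)).
rewrite (bigD1 i) /=; last by rewrite /consecutive ik eqxx orbT.
have := x_gt0 k; have [kn | kn] := ltnP k.+1 n.
  have kk : (q - 3) * x (Ordinal kn) < x k.
    by apply: IH => //=; lia.
  rewrite (bigD1 (Ordinal kn)) /=; last first.
    by rewrite /consecutive -val_eqE /=; lia.
  rewrite big_pred0 => [|j]; last by rewrite /consecutive -!val_eqE /=; lia.
  have := x_gt0 (Ordinal kn) => h1 h2 h3; nra.
rewrite big_pred0 => [|j]; last first.
  by have := ltn_ord j; rewrite /consecutive -!val_eqE /=; lia.
by move=> h1 h2; lra.
Qed.

Lemma kite_q1_ge4 : (w < n)%N -> 4 <= q.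
Proof.
move=> wn; have n_gt0 : (0 < n)%N by exact: leq_ltn_trans wn.
have ltn_w (k : nat) : (k <= w)%N -> (k < n)%N by move=> kw; exact: leq_ltn_trans wn.
have w1 : (w.-1 <= w)%N by exact: leq_pred.
(* The joint [w - 1] has the neighbours [0], [1] and [w]. *)
have := @q1_ge4_degree3 R _ _ (@kite_graph_sym n w) (kite_graph_connected w n_gt0)
  (Ordinal (ltn_w _ w1)) (Ordinal n_gt0)
  (Ordinal (ltn_w 1%N w_gt0)) (Ordinal wn).
rewrite !kite_graph_joint /= ?prednK // -!val_eqE /=; apply; lia.
Qed.

(** From the joint [c] onwards this is the previous estimate. For [i] in the clique off the joint,
    the clique rows give [x c = (q - 2 w + 3) x i], at most [(q - 3) x i] as [w >= 3]. At the first
    path vertex [p], [(q - 3) x p < x c], so [x p < x i]. *)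
Lemma kite_perron_decreasing i j : (w <= j)%N -> (i < j)%N -> x j < x i.
Proof.
move=> wj ij; have wn : (w < n)%N by exact: leq_ltn_trans (ltn_ord j).
have q4 := kite_q1_ge4 wn.
have step (a b : 'I_n) : (w <= b)%N -> a.+1 = b :> nat -> x b < x a.
  move=> wb ab; have := kite_perron_path wb ab q4; have := x_gt0 b; nra.
have path_dec (a b : 'I_n) : (w <= a.+1)%N -> (a < b)%N -> x b < x a.
  move=> wa; case: b => b; elim: b => // b IH bn; rewrite ltnS leq_eqVlt.
  case/predU1P => [ab | ab]; first by apply: step => //=; lia.
  have bn' : (b < n)%N by exact: ltnW.
  apply: lt_trans (IH bn' ab); apply: step => //=; lia.
have [wi | iw] := leqP w i.+1; first exact: path_dec.
have cn : (w.-1 < n)%N by lia.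
pose c := Ordinal cn; pose p := Ordinal wn.
apply: (@le_lt_trans _ _ (x p)).
  have [pj | jp] := ltnP p j; first by rewrite ltW // path_dec //=; lia.
  by rewrite (_ : j = p) //; apply: val_inj => /=; apply/eqP; rewrite eqn_leq wj jp.
have cp : (q - 3) * x p < x c by apply: kite_perron_path => //=; lia.
(* Multiplied by [x i > 0], this factor becomes the positive sum [S]. *)
have qw : 0 < q - w%:R + 2.
  rewrite -(pmulr_lgt0 _ (x_gt0 i)) kite_perron_clique // /S (bigD1 i) /= ?(ltnW iw) //.
  by rewrite ltr_pwDl // sumr_ge0 // => k _; exact: ltW.
have xci : (q - 2 * w%:R + 3) * x i = x c.
  have : S = (w.-1)%:R * x i + x c.
    rewrite /S (bigD1 c) /= ?prednK // addrC; congr (_ + _).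
    rewrite (eq_bigl (fun k : 'I_n => (k < w.-1)%N)); last first.
      by move=> k; rewrite -val_eqE /=; lia.
    rewrite (eq_bigr (fun=> x i)) => [|k kw].
      rewrite -(big_ord_widen n (fun=> x i)); last by lia.
      by rewrite sumr_const card_ord mulr_natl.
    apply: (mulfI (lt0r_neq0 qw)); rewrite !kite_perron_clique //; lia.
  have wE : w%:R = w.-1%:R + 1 :> R by rewrite natr1 prednK.
  by rewrite -(kite_perron_clique iw) wE => h; lra.
have w3 : 3 <= w%:R :> R by rewrite ler_nat.
have : (q - 3) * x p < (q - 3) * x i.
  apply: (lt_le_trans cp); rewrite -xci ler_pM2r //; lra.
by rewrite ltr_pM2l //; lra.
Qed.

End KitePerron.

(** * Comparing the energies of a graph and of the kite *)

Section EnergyByLargerEndpoint.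
Variables (R : realType) (n : nat) (e : rel 'I_n) (x : 'I_n -> R).
Hypotheses (sym_e : symmetric e) (irr_e : irreflexive e).
(** Charging each edge to its larger endpoint allows a comparison vertex by vertex. *)
Lemma energy_lt_sum : energy e x =
  2 * \sum_(j < n) \sum_(i < n | (i < j)%N && e i j) (x i + x j) ^+ 2.
Proof.
rewrite mulr_natl mulr2n /energy.
under eq_bigr => j _ do rewrite (bigID (fun i : 'I_n => (i < j)%N)) /=.
rewrite big_split /=; congr (_ + _).
  apply: eq_bigr => j _; apply: eq_big => [i|i _]; last by rewrite addrC.
  by rewrite andbC sym_e.
rewrite (exchange_big_dep xpredT) //=; apply: eq_bigr => j _.
apply: eq_bigl => i; rewrite -leqNgt leq_eqVlt.
by have [/val_inj ->|_] := eqVneq (val i) (val j); rewrite ?irr_e ?andbF //= andbC.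
Qed.

End EnergyByLargerEndpoint.

Section KiteComparison.
Variables (R : realType) (n w : nat) (e : rel 'I_n) (x : 'I_n -> R).
Hypotheses (sym_e : symmetric e) (irr_e : irreflexive e).
Hypothesis w_gt0 : (0 < w)%N.
Hypothesis x_gt0 : forall i, 0 < x i.
Hypothesis x_dec : forall i j : 'I_n, (w <= j)%N -> (i < j)%N -> x j < x i.
Hypothesis e_clique : forall i j : 'I_n, (i < w)%N -> (j < w)%N -> i != j -> e i j.
Hypothesis e_attached : forall k : 'I_n, (w <= k)%N ->
  exists2 i : 'I_n, (i < k)%N & e i k.
Hypothesis e_joint : forall i k : 'I_n, i.+1 = w -> k = w :> nat -> e i k.

Let down (f : rel 'I_n) (j : 'I_n) := \sum_(i < n | (i < j)%N && f i j) (x i + x j) ^+ 2.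

(** For [j < w] both graphs join [j] to all smaller vertices. For [j >= w] the kite has only the
    edge from [j - 1]: if [e] has it too, further edges add positive terms; otherwise an earlier
    neighbour gives a larger term. *)
Lemma down_energy_le j : down (@kite_graph n w) j <= down e j /\
  ((exists2 i : 'I_n, (i < j)%N & e i j != kite_graph w i j) ->
    down (@kite_graph n w) j < down e j).
Proof.
have sq_gt0 (i : 'I_n) : 0 < (x i + x j) ^+ 2 by rewrite exprn_gt0 ?addr_gt0.
have [jw | wj] := ltnP j w.
  have eE (i : 'I_n) : (i < j)%N -> e i j = kite_graph w i j.
    move=> ij; rewrite kite_graph_lt // jw e_clique //; first exact: ltn_trans jw.
    by rewrite -val_eqE /=; lia.
  split=> [|[i ij]]; last by rewrite eE // eqxx.
  rewrite /down le_eqVlt; apply/orP; left; apply/eqP; apply: eq_bigl => i.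
  by case: ltnP => //= ij; rewrite eE.
have pn : (j.-1 < n)%N by exact: leq_ltn_trans (leq_pred _) (ltn_ord j).
pose p := Ordinal pn; have j_gt0 : (0 < j)%N by exact: leq_trans wj.
have kE (i : 'I_n) : (i < j)%N -> kite_graph w i j = (i == p).
  by move=> ij; rewrite kite_graph_lt // -val_eqE /=; lia.
have -> : down (@kite_graph n w) j = (x p + x j) ^+ 2.
  rewrite /down (big_pred1 p) // => i; case: ltnP => ij /=; first exact: kE.
  by rewrite -val_eqE /=; lia.
have pj : (p < j)%N by rewrite /= prednK.
have rest_ge0 (P : pred 'I_n) : 0 <= \sum_(i | P i) (x i + x j) ^+ 2.
  by apply: sumr_ge0 => i _; exact: ltW.
have [epj | epj] := boolP (e p j).
  rewrite /down (bigD1 p) ?pj //=; split; first by rewrite lerDl.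
  move=> [i ij]; rewrite kE // => ei.
  have [ip|ip] := eqVneq i p; first by rewrite ip epj eqxx in ei.
  rewrite ltrDl (bigD1 i) /=; first by rewrite ltr_pwDl.
  by move: ei; rewrite ij (negbTE ip); case: (e i j).
suff lt : (x p + x j) ^+ 2 < down e j by split=> // ; exact: ltW.
have [i ij eij] := e_attached wj.
have ip : i != p by apply: contraNneq epj => <-.
(* The joint edge excludes [j = w]. This matters because [x_dec] does not compare two clique
   vertices. *)
have wp : (w <= p)%N.
  rewrite leqNgt; apply: contra epj => pw.
  by apply: e_joint => /=; move: pw => /=; lia.
have lt_ip : (i < p)%N by move: ip; rewrite -val_eqE /=; lia.
rewrite /down (bigD1 i) /= ?ij //; apply: ltr_wpDr; first exact: rest_ge0.
by rewrite ltrXn2r // ?nnegrE ?addr_ge0 ?(ltW (x_gt0 _)) // ltrD2r x_dec.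
Qed.

Lemma kite_energy_le : energy (@kite_graph n w) x <= energy e x.
Proof.
rewrite (energy_lt_sum x (@kite_graph_sym n w) (@kite_graph_irr n w)).
  rewrite (energy_lt_sum x sym_e irr_e).
rewrite ler_pM2l //; apply: ler_sum => j _; exact: (down_energy_le j).1.
Qed.

Lemma kite_energy_eq : energy (@kite_graph n w) x = energy e x ->
  forall i j, e i j = kite_graph w i j.
Proof.
move=> eqE; have lt_case (i j : 'I_n) : (i < j)%N -> e i j = kite_graph w i j.
  move=> ij; apply/eqP/negPn/negP => ne.
  suff : energy (@kite_graph n w) x < energy e x by rewrite eqE ltxx.
  rewrite (energy_lt_sum x (@kite_graph_sym n w) (@kite_graph_irr n w)).
  rewrite (energy_lt_sum x sym_e irr_e).
  rewrite ltr_pM2l // (bigD1 j) //= [ltRHS](bigD1 j) //=.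
  apply: ltr_leD; first by apply: (down_energy_le j).2; exists i.
  by apply: ler_sum => k _; exact: (down_energy_le k).1.
move=> i j; have [ij|ji|/val_inj ->] := ltngtP i j.
- exact: lt_case.
- by rewrite sym_e kite_graph_sym lt_case.
- by rewrite irr_e kite_graph_irr.
Qed.

End KiteComparison.

(** * Orderings that start with a clique *)

Section CliqueOrdering.
Variables (T : finType) (e : rel T).
Hypotheses (simple_e : simple_graph e) (conn_e : connected_graph e).

(** An edge [u v] leaving [A] dictates the order: [A] with [u] last, then [v], then a greedy
    extension. *)
Lemma clique_ordering (A : {set T}) : clique e A -> (0 < #|A|)%N ->
  exists2 h : 'I_#|T| -> T, bijective h &
  [/\ forall i j : 'I_#|T|, (i < #|A|)%N -> (j < #|A|)%N -> i != j -> e (h i) (h j),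
      forall k : 'I_#|T|, (#|A| <= k)%N -> exists2 i : 'I_#|T|, (i < k)%N & e (h i) (h k)
    & forall i k : 'I_#|T|, i.+1 = #|A| -> k = #|A| :> nat -> e (h i) (h k)].
Proof.
have [sym_e irr_e] := simple_e.
move=> /forall_inP clA A_gt0.
(* If [A] contains every vertex, no edge leaves it and any [u] will do. *)
have [u [uA exit]] : exists u, u \in A /\ ((#|A| < #|T|)%N -> exists2 v, v \notin A & e u v).
  have [a aA] := card_gt0P A_gt0.
  have [AT|AT] := leqP #|T| #|A|; first by exists a; split=> //; rewrite ltnNge AT.
  have [b bA] : exists b, b \notin A.
    apply/existsP; rewrite -negb_forall; apply: contraL AT => /forallP AT.
    rewrite -leqNgt; apply/eq_leq/esym/eq_card => v.
    by rewrite (AT v).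
  have [u [v [uA vA euv]]] := crossing_edge sym_e conn_e aA bA.
  by exists u; split=> // _; exists v.
pose s0 := rcons (enum (A :\ u)) u.
have us0 : uniq s0 by rewrite rcons_uniq enum_uniq mem_enum !inE eqxx.
have ss0 : size s0 = #|A| by rewrite size_rcons -cardE (cardsD1 u A) uA.
have s0A v : v \in s0 = (v \in A).
  by rewrite mem_rcons inE mem_enum !inE; case: eqVneq => [->|].
have main (h : 'I_#|T| -> T) : bijective h ->
    (forall x0 (i : 'I_#|T|), (i < #|A|)%N -> h i = nth x0 s0 i) ->
    forall i j : 'I_#|T|, (i < #|A|)%N -> (j < #|A|)%N -> i != j -> e (h i) (h j).
  move=> hb hs i j iA jA ij.
  have hA (k : 'I__) : (k < #|A|)%N -> h k \in A.
    by move=> kA; rewrite (hs u) // -s0A mem_nth ?ss0.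
  have /forall_inP /(_ _ (hA j jA)) /implyP := clA _ (hA i iA); apply.
  by rewrite (inj_eq (bij_inj hb)).
have [AT|AT] := leqP #|T| #|A|.
  have [|h hb [hs _]] := attached_ordering sym_e conn_e us0; first by rewrite ss0.
  rewrite ss0 in hs; exists h => //; split; first exact: main.
    by move=> k; rewrite leqNgt (leq_trans (ltn_ord k) AT).
  by move=> i k _ kA; move: (ltn_ord k); rewrite kA ltnNge AT.
have [v vA euv] := exit AT.
have us1 : uniq (rcons s0 v) by rewrite rcons_uniq s0A vA us0.
have [|h hb [hs hatt]] := attached_ordering sym_e conn_e us1; first by rewrite size_rcons.
have hs0 x0 (i : 'I_#|T|) : (i < #|A|)%N -> h i = nth x0 s0 i.
  move=> iA; have iA' : (i < size (rcons s0 v))%N.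
    by rewrite size_rcons ss0 ltnS ltnW.
  by rewrite (hs x0 _ iA') nth_rcons ss0 iA.
have joint : forall i k : 'I_#|T|, i.+1 = #|A| -> k = #|A| :> nat -> e (h i) (h k).
  move=> i k iA kA.
  have -> : h i = u.
    have iu : #|A :\ u| = i by move: iA; rewrite (cardsD1 u A) uA; lia.
    by rewrite (hs0 u) -?iA // nth_rcons -cardE iu ltnn eqxx.
  have kA' : (k < size (rcons s0 v))%N by rewrite size_rcons ss0 kA.
  by rewrite (hs u _ kA') nth_rcons ss0 kA ltnn eqxx.
exists h => //; split=> //; first exact: main.
(* [hatt] only covers positions after [v]; position [#|A|] is attached by the joint edge. *)
move=> k; rewrite leq_eqVlt => /predU1P [Ak | Ak]; last first.
  by apply: hatt; rewrite size_rcons ss0.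
have iT : (#|A|.-1 < #|T|)%N by lia.
by exists (Ordinal iT); [rewrite /= -Ak prednK | apply: joint; rewrite /= ?prednK].
Qed.

End CliqueOrdering.

(** * Paths, and graphs with [q1] below 4 *)

Section PathGraphs.
Variables (R : realType).

Lemma path_graph_sym n : symmetric (@path_graph n).
Proof. by move=> i j; rewrite /path_graph /consecutive; lia. Qed.

Lemma path_graph_connected n : (0 < n)%N -> connected_graph (@path_graph n).
Proof.
move=> n_gt0; split; first by rewrite card_ord.
have conn0 (k : 'I_n) : connect (@path_graph n) (Ordinal n_gt0) k.
  case: k => k; elim: k => [|k IH] kn.
    by rewrite (_ : Ordinal kn = Ordinal n_gt0) ?connect0 //; exact: val_inj.
  apply: (connect_trans (IH (ltnW kn))); apply: connect1.
  by rewrite /path_graph /consecutive /= eqxx.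
move=> i j; apply: connect_trans (conn0 j).
by rewrite (sym_connect_sym (@path_graph_sym n)).
Qed.

(* The formula [f (i - 1) + f (i + 1) = 2 cos t f i] for [f i = sin ((i + 1/2) t)]
    also makes [f (-1) + f 0] and [f (n - 1) + f n] vanish when [t = pi / n],
   so the two missing edges do not matter. *)
Lemma q1_path_graph n : (0 < n)%N ->
  q1 R (@path_graph n) = 2 + 2 * cos (pi / n%:R).
Proof.
move=> n_gt0; set t : R := pi / n%:R.
have n0 : n%:R != 0 :> R by rewrite pnatr_eq0 -lt0n.
have tn : n%:R * t = pi by rewrite /t mulrCA divff // mulr1.
have t_gt0 : 0 < t by rewrite divr_gt0 ?pi_gt0 ?ltr0n.
pose f (k : nat) : R := sin ((k%:R + 2^-1) * t).
have fS k : f k + f k.+2 = 2 * cos t * f k.+1.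
  rewrite /f.
  have -> : (k%:R + 2^-1) * t = (k.+1%:R + 2^-1) * t - t by rewrite -natr1; ring.
  have -> : (k.+2%:R + 2^-1) * t = (k.+1%:R + 2^-1) * t + t.
    by rewrite -[k.+2%:R]natr1; ring.
  by rewrite sinB sinD; ring.
have f01 : f 0%N + f 1%N = (2 + 2 * cos t) * f 0%N.
  rewrite /f.
  have -> : (1%:R + 2^-1) * t = (0%:R + 2^-1) * t + t by ring.
  (* With [s = t / 2] the claim is [sin s + sin (3 s) = (2 + 2 cos (2 s)) sin s]. *)
  have : t = (0%:R + 2^-1) * t + (0%:R + 2^-1) * t by field.
  move: ((0%:R + 2^-1) * t) => s ->.
  rewrite sinD (_ : s + s = s *+ 2) // sin_mulr2n cos_mulr2n.
  ring.
have flast : f n + f n.-1 = 0.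
  rewrite /f.
  have -> : (n%:R + 2^-1) * t = 2^-1 * t + pi by rewrite mulrDl tn addrC.
  have -> : (n.-1%:R + 2^-1) * t = - (2^-1 * t) + pi.
    have : n%:R = n.-1%:R + 1 :> R by rewrite natr1 prednK.
    by move=> nE; rewrite -tn nE; field.
  by rewrite !sinDpi sinN opprK addNr.
apply: (positive_eigenvector_q1 (@path_graph_sym n) (path_graph_connected n_gt0)
  (x := fun i : 'I_n => f i)).
  (* The arguments of the sines lie strictly between 0 and [n t = pi]. *)
  move=> i; have ih : (0 : R) < i%:R + 2^-1 by rewrite ltr_wpDl ?invr_gt0.
  rewrite /f sin_gt0_pi // mulr_gt0 //= -tn ltr_pM2r //.
  apply: (@lt_le_trans _ _ (i%:R + 1)); last by rewrite natr1 ler_nat.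
  by rewrite ltrD2l invf_lt1 // ltr1n.
move=> i; rewrite /signless_op.
have [i0|i_gt0] := posnP i.
  have [n1 | n1] := ltnP 1 n.
    rewrite (big_pred1 (Ordinal n1)) /=; last first.
      by move=> j; rewrite /path_graph /consecutive /= -val_eqE /= i0; lia.
    by rewrite i0.
  (* Here [n = 1]: the row is empty, and [f 0 + f 1 = 0] by [flast]. *)
  rewrite big_pred0; last first.
    by move=> j; have := ltn_ord j; rewrite /path_graph /consecutive; lia.
  have nE : n = 1%N by apply/eqP; rewrite eqn_leq n1.
  by rewrite i0 -f01 addrC; move: flast; rewrite nE.
have pn : (i.-1 < n)%N by exact: leq_ltn_trans (leq_pred _) (ltn_ord i).
rewrite (bigD1 (Ordinal pn)) /=; last by rewrite /path_graph /consecutive /=; lia.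
have fi : f i.-1 + f i.+1 = 2 * cos t * f i by have := fS i.-1; rewrite prednK.
have [i1 | i1] := ltnP i.+1 n.
  rewrite (big_pred1 (Ordinal i1)) /=; last first.
    by move=> j; rewrite /path_graph /consecutive /= -!val_eqE /=; lia.
  by lra.
rewrite big_pred0; last first.
  by move=> j; have := ltn_ord j; rewrite /path_graph /consecutive /= -val_eqE /=; lia.
have nE : n = i.+1 by apply/eqP; rewrite eqn_leq i1 ltn_ord.
have fl : f i.+1 + f i = 0 by rewrite -[RHS]flast; congr (f _ + f _); lia.
by lra.
Qed.

Lemma path_graph_q1_lt4 n : (1 < n)%N -> q1 R (@path_graph n) < 4.
Proof.
move=> n1; have n_gt0 : (0 < n)%N by exact: ltnW.
have n_gt0R : 0 < n%:R :> R by rewrite ltr0n.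
rewrite q1_path_graph //; suff : cos (pi / n%:R) < 1 :> R by lra.
rewrite -[ltRHS]cos0 ltr_cos ?in_itv /= ?lexx ?pi_ge0 //.
  by rewrite divr_gt0 ?pi_gt0.
apply/andP; split; first by rewrite divr_ge0 ?pi_ge0 ?ler0n.
by rewrite ler_pdivrMr // ler_peMr ?pi_ge0 // ler1n.
Qed.

(** An edge from [i] to some [j > i + 1] would overload [i], which is already joined to [i + 1] and,
    if [i > 0], to [i - 1]. This [clash] first forces each vertex to attach to its predecessor, then
    excludes all other edges. *)
Lemma path_graph_of_degree_le2 n (f : rel 'I_n) :
  symmetric f -> irreflexive f ->
  (forall u a b c, f u a -> f u b -> f u c -> a != b -> a != c -> b != c -> False) ->
  (forall u a b : 'I_n, u = 0%N :> nat -> f u a -> f u b -> a = b) ->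
  (forall k : 'I_n, (0 < k)%N -> exists2 i : 'I_n, (i < k)%N & f i k) ->
  forall i j, f i j = path_graph i j.
Proof.
move=> sym_f irr_f deg2 deg1 att.
have clash (i j : 'I_n) : f i j -> (i.+1 < j)%N ->
    (forall a b : 'I_n, (b < j)%N -> a.+1 = b -> f a b) -> False.
  move=> fij ij fS; have i1n : (i.+1 < n)%N by exact: ltn_trans (ltn_ord j).
  have fi1 : f i (Ordinal i1n) by exact: fS.
  have [i0|i_gt0] := posnP i.
    have := deg1 _ _ _ i0 fij fi1 => /(congr1 val) /=; lia.
  have pn : (i.-1 < n)%N by exact: leq_ltn_trans (leq_pred _) (ltn_ord i).
  have fip : f i (Ordinal pn) by rewrite sym_f; apply: fS => //=; lia.
  by apply: (deg2 _ _ _ _ fij fi1 fip); rewrite -val_eqE /=; lia.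
have fS (a b : 'I_n) : a.+1 = b -> f a b.
  move: {2}b.+1 (ltnSn b) => m; elim: m a b => // m IH a b bm ab.
  have [|i ib fib] := att b; first by lia.
  have [ia | ia] := eqVneq i a; first by rewrite -ia.
  case: (clash _ _ fib); first by move: ia; rewrite -val_eqE /=; lia.
  by move=> c d db cd; apply: IH => //; lia.
have lt_case (i j : 'I_n) : (i < j)%N -> f i j = path_graph i j.
  move=> ij; rewrite /path_graph /consecutive.
  have [ij1|ij1] := eqVneq i.+1 j; first by rewrite fS.
  rewrite gtn_eqF /= ?ltnS ?(ltnW ij) //.
  apply/negP => fij; apply: (clash _ _ fij); first by lia.
  by move=> a b _; exact: fS.
move=> i j; have [ij|ji|/val_inj ->] := ltngtP i j.
- exact: lt_case.
- by rewrite sym_f path_graph_sym lt_case.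
- by rewrite irr_f /path_graph /consecutive; lia.
Qed.

Lemma path_or_q1_ge4 (T : finType) (e : rel T) :
  simple_graph e -> connected_graph e ->
  graph_iso e (@path_graph #|T|) \/ 4 <= q1 R e.
Proof.
move=> [sym_e irr_e] conn_e.
have [deg3|deg2] := boolP [exists u, exists a, exists b, exists c,
  [&& e u a && e u b, e u c, a != b, a != c & b != c]].
  case/existsP: deg3 => u /existsP[a] /existsP[b] /existsP[c].
  case/and5P=> /andP[*]; right; exact: (@q1_ge4_degree3 R _ _ sym_e conn_e u a b c).
have [deg1|/existsPn end1] := boolP [forall u, 1 < degree e u]%N.
  right; have [_ _ _] := q1_rayleigh R sym_e conn_e.1.
  have [qmax _ _ _] := q1_rayleigh R sym_e conn_e.1 => _.
  (* For the constant vector each vertex contributes 4 times its degree, at least 8, to the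
     energy. *)
  have := qmax (fun _ : T => 1).
  have -> : sqnorm (fun _ : T => 1) = #|T|%:R :> R.
    by rewrite /sqnorm; under eq_bigr do rewrite expr1n; rewrite sumr_const.
  have : \sum_(u : T) 8 <= energy e (fun _ : T => 1) :> R.
    apply: ler_sum => u _; rewrite sumr_const -[_ ^+ 2]/((1 + 1) * (1 + 1)).
    have /forallP /(_ u) := deg1; rewrite /degree cardsE => du.
    have : 2 <= #|e u|%:R :> R by rewrite ler_nat.
    by rewrite -mulr_natr => h; lra.
  rewrite sumr_const -[8 *+ _]mulr_natr => h1 h2; have := le_trans h1 h2.
  rewrite ler_pM2r ?ltr0n ?conn_e.1 //; lra.
have {}deg2 u a b c : e u a -> e u b -> e u c -> a != b -> a != c -> b != c -> False.
  move=> *; apply: (negP deg2); apply/existsP; exists u; apply/existsP; exists a.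
  by apply/existsP; exists b; apply/existsP; exists c; apply/and5P; split=> //; apply/andP.
left; have {end1} [r r1] : exists r, ~~ (1 < degree e r)%N by exact/existsP/existsPn.
(* The ordering starts at [r], so vertex [0] has at most one neighbour. *)
have [//|//|h hb [hs att]] := @attached_ordering _ _ sym_e conn_e [:: r].
apply: graph_iso_sym; exists h => // i j.
apply: (@path_graph_of_degree_le2 _ (relpre h e)).
- by move=> a b /=; rewrite sym_e.
- by move=> a /=; rewrite irr_e.
- move=> u a b c ua ub uc ab ac bc.
  by apply: (deg2 _ _ _ _ ua ub uc); rewrite (inj_eq (bij_inj hb)).
- move=> u a b u0 /=; rewrite (hs r) ?u0 //= => ra rb.
  apply/(bij_inj hb)/eqP; apply: contraNT r1 => ne.
  have /subset_leq_card : [set h a; h b] \subset [set y | e r y].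
    by apply/fintype.subsetP => y; rewrite !inE => /orP[] /eqP ->.
  by rewrite cards2 ne.
- exact: att.
Qed.

End PathGraphs.

(** * Extremality of the path and of the kite *)

Theorem theorem3p1 (R : realType) (T : finType) (e : rel T) (n w : nat)
    (simple_e : simple_graph e) (conn_e : connected_graph e)
    (order_e : #|T| = n) (clique_e : clique_number e = w) :
  (w = 2%N ->
     2 + 2 * cos (pi / n%:R) <= q1 R e /\
     (q1 R e = 2 + 2 * cos (pi / n%:R) <-> graph_iso e (@path_graph n))) /\
  ((3 <= w)%N ->
     q1 R (@kite_graph n w) <= q1 R e /\
     (q1 R e = q1 R (@kite_graph n w) <-> graph_iso e (@kite_graph n w))).
Proof.
have [sym_e irr_e] := simple_e.
have [A clA cardA] : exists2 A, clique e A & #|A| = w.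
  have cl_gt0 : (0 < #|clique e|)%N.
    by apply/card_gt0P; exists finset.set0; apply/forall_inP => u; rewrite inE.
  have [A clA AE] := eq_bigmax_cond (fun A : {set T} => #|A|) cl_gt0.
  by exists A; rewrite // -clique_e -AE.
have w_le_n : (w <= n)%N by rewrite -cardA -order_e max_card.
split=> [w2 | w_ge3].
  have n_gt1 : (1 < n)%N by rewrite -w2.
  rewrite -q1_path_graph ?(ltnW n_gt1) //.
  have path_q1 := q1_iso R sym_e (@path_graph_sym n).
  have lt4 := path_graph_q1_lt4 R n_gt1.
  have [|q4] := path_or_q1_ge4 R simple_e conn_e.
    by rewrite order_e => e_path; rewrite path_q1.
  (* When [q1 >= 4] the inequality is strict, so equality and isomorphism to the path are both
     impossible. *)
  have lt_q1 := lt_le_trans lt4 q4.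
  split; first exact: ltW.
  by split=> [eqE|/path_q1 eqE]; move: lt_q1; rewrite eqE ltxx.
have [h hb [h_clique h_att h_joint]] := clique_ordering simple_e conn_e clA
  (ltac:(by rewrite cardA (leq_trans _ w_ge3))).
subst n; rewrite cardA in h_clique h_att h_joint.
have w_gt0 : (0 < w)%N by exact: leq_trans w_ge3.
have kite_sym := @kite_graph_sym #|T| w.
have [f f_gt0 fE] := perron R kite_sym (kite_graph_connected w conn_e.1).
(* The graph moved to the vertices of the kite, where the Perron vector [f] of the kite serves as
   test vector. *)
set g := relpre h e.
have g_sym : symmetric g by move=> i j; rewrite /g /= sym_e.
have g_irr : irreflexive g by move=> i; rewrite /g /= irr_e.
have g_iso : graph_iso g e by exact: graph_iso_relpre.
have f_dec := kite_perron_decreasing w_ge3 w_le_n f_gt0 fE.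
have energy_le := kite_energy_le g_sym g_irr w_gt0 f_gt0 f_dec h_clique h_att h_joint.
have energy_eq := kite_energy_eq g_sym g_irr w_gt0 f_gt0 f_dec h_clique h_att h_joint.
have f_norm : 0 < 2 * sqnorm f.
  rewrite mulr_gt0 // /sqnorm (bigD1 (Ordinal conn_e.1)) //=.
  by rewrite ltr_pwDl ?exprn_gt0 // sumr_ge0 // => i _; exact: sqr_ge0.
have kite_energy : energy (@kite_graph #|T| w) f =
    q1 R (@kite_graph #|T| w) * (2 * sqnorm f).
  rewrite energy_op // mulrCA; congr (_ * _); rewrite /sqnorm mulr_sumr.
  by apply: eq_bigr => i _; rewrite fE expr2 mulrCA.
have [g_max _ _ _] : _ := q1_rayleigh R g_sym (ltac:(by rewrite card_ord; exact: conn_e.1)).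
have := g_max f; rewrite (q1_iso R g_sym sym_e g_iso) mulrAC => g_le.
split.
  rewrite -(ler_pM2r f_norm) -kite_energy; apply: (le_trans energy_le).
  by rewrite mulrC.
split=> [q1E | e_kite]; last by rewrite (q1_iso R sym_e kite_sym e_kite).
(* If the [q1] agree, the energy of [g] at [f] lies between two copies of the kite energy. *)
have gE : forall i j, g i j = kite_graph w i j.
  apply: energy_eq; apply/eqP; rewrite eq_le energy_le /= kite_energy -q1E.
  by rewrite mulrC.
by apply: graph_iso_sym; exists h.
Qed.
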